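(* Let $p$ be a complex polynomial of degree $d \geq 2$, and let $H_p = \operatorname{conv} J_p$ be the convex hull of its Julia set. Then $p^{-1}(H_p) \subset H_p$.
   Context: For a polynomial $p$ viewed as a holomorphic self-map of the Riemann sphere $\widehat{\mathbb{C}}$ (with $p(\infty)=\infty$), the Fatou set $F_p$ is the maximal open subset of $\widehat{\mathbb{C}}$ on which the iterates $\{p^{\circ n}\}_{n\in\mathbb{N}}$ form an equicontinuous family, and the Julia set $J_p$ is the complement $\widehat{\mathbb{C}}\setminus F_p$; for polynomials $J_p$ is a nonempty compact subset of $\mathbb{C}$. $\operatorname{conv} X$ denotes the convex hull of $X \subset \mathbb{C}\cong\mathbb{R}^2$. *)

(* Defs.v *)
From HB Require Import structures.
From mathcomp Require Import all_boot all_order all_algebra.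
From mathcomp Require Import complex.
From mathcomp Require Import reals.
Set Implicit Arguments. Unset Strict Implicit. Unset Printing Implicit Defensive.
Import Order.TTheory GRing.Theory Num.Theory.
Local Open Scope ring_scope.

Section Julia.
Variable R : realType.
Local Notation C := R[i].

Definition cabs (z : C) : R := Normc.normc z.

Definition chordal (z w : C) : R :=
  2 * cabs (z - w) / Num.sqrt ((1 + cabs z ^+ 2) * (1 + cabs w ^+ 2)).

Definition piter (p : {poly C}) (n : nat) (z : C) : C := iter n (fun x => p.[x]) z.

(* The family of iterates {p^n} is equicontinuous at z (spherical metric on
   the target; near a finite point the sphere topology is the Euclidean one). *)
Definition equicont_at (p : {poly C}) (z : C) : Prop :=
  forall eps : R, 0 < eps -> exists2 delta : R, 0 < delta &
    forall (n : nat) (y : C), cabs (y - z) < delta ->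
      chordal (piter p n y) (piter p n z) < eps.

Definition fatou (p : {poly C}) (z : C) : Prop :=
  exists2 r : R, 0 < r & forall w : C, cabs (w - z) < r -> equicont_at p w.

(* Julia set (a subset of C for polynomials). *)
Definition julia (p : {poly C}) (z : C) : Prop := ~ fatou p z.

Definition convex_set (S : C -> Prop) : Prop :=
  forall a b : C, S a -> S b -> forall t : R, 0 <= t <= 1 ->
    S (real_complex R t * a + real_complex R (1 - t) * b).

Definition conv (X : C -> Prop) (z : C) : Prop :=
  forall S : C -> Prop, convex_set S -> (forall x, X x -> S x) -> S z.

End Julia.

(* Main.v *)
Require Import Defs.
From HB Require Import structures.
From mathcomp Require Import all_boot all_order all_algebra.
From mathcomp Require Import complex.
From mathcomp Require Import reals.
From mathcomp Require Import ring.
Import Order.TTheory GRing.Theory Num.Theory.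
Local Open Scope ring_scope.

(** Call [G] the convex hull of the Julia set and [S] the set of points all of
    whose preimages under [p] lie in [G]. The Fatou set is forward invariant
    because [p] is open, so the Julia set is contained in [S]; hence it suffices
    that [S] is convex. If [p z = t a + (1 - t) b], with [r_i] and [s_j] the
    solutions of [p = a] and [p = b], then the logarithmic derivatives of
    [p - a] and [p - b] at [z] give
    [(1 - t) * sum_i 1 / (z - r_i) + t * sum_j 1 / (z - s_j) = 0].
    As in the Gauss-Lucas theorem, conjugating this equation exhibits [z] as a
    convex combination of the [r_i] and [s_j]. *)

Lemma horner_deriv_prod_XsubC (F : fieldType) (c : F) (rs : seq F) (z : F) :
  z \notin rs ->
  (c *: \prod_(r <- rs) ('X - r%:P))^`().[z] =
  (c *: \prod_(r <- rs) ('X - r%:P)).[z] * \sum_(r <- rs) (z - r)^-1.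
Proof.
rewrite derivZ !hornerZ -mulrA => zrs; congr (c * _).
elim: rs zrs => [|r rs IH]; first by rewrite !big_nil derivC hornerC mulr0.
rewrite inE negb_or -subr_eq0 => /andP[zr /IH {}IH].
rewrite !big_cons derivM derivXsubC mul1r hornerD !hornerM IH hornerXsubC.
by rewrite mulrDr [_ * _ / _]mulrAC divff// mul1r mulrA.
Qed.

Lemma root_scale_prod_XsubC (F : fieldType) (c : F) (rs : seq F) (z : F) :
  c != 0 -> ((c *: \prod_(r <- rs) ('X - r%:P)).[z] == 0) = (z \in rs).
Proof. by move=> c0; rewrite -rootE rootZ// root_prod_XsubC. Qed.

(** Factoring [q], the modulus of [q.[z]] is that of the leading coefficient times the product of
    the distances from [z] to the roots. If every distance were at least [e], the assumed bound
    would fail. *)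
Lemma near_root (F : numClosedFieldType) (q : {poly F}) (z e : F) :
  0 < e -> `|q.[z]| < `|lead_coef q| * e ^+ (size q).-1 ->
  exists2 r, q.[r] = 0 & `|z - r| < e.
Proof.
move=> e0; have [rs Dq] := closed_field_poly_normal q => qz.
have [q0|q0] := eqVneq q 0.
  by move: qz; rewrite q0 horner0 lead_coef0 normr0 mul0r ltxx.
have c0 : lead_coef q != 0 by rewrite lead_coef_eq0.
have [/hasP[r rrs zr]|] := boolP (has (fun r => `|z - r| < e) rs).
  by exists r => //; apply/eqP; rewrite Dq root_scale_prod_XsubC.
rewrite -all_predC => /allP far; move: qz.
rewrite {1}Dq hornerZ normrM ltr_pM2l ?normr_gt0// horner_prod normr_prod.
have -> : (size q).-1 = size rs.
  by rewrite [in LHS]Dq size_scale// size_prod_XsubC.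
suff h : e ^+ size rs <= \prod_(r <- rs) `|('X - r%:P).[z]|.
  by move=> /(le_lt_trans h); rewrite ltxx.
elim: rs far {Dq} => [|r rs IH] far; first by rewrite big_nil expr0.
rewrite big_cons /= exprS ler_pM ?exprn_ge0 ?(ltW e0)//.
  rewrite hornerXsubC real_leNgt ?realE ?normr_ge0 ?(ltW e0)//.
  exact: (far r (mem_head _ _)).
by apply: IH => s srs; apply: far; rewrite inE srs orbT.
Qed.

Section ComplexPlane.
Variable R : realType.
Local Notation C := R[i].
Implicit Types (S X : C -> Prop) (p : {poly C}).

Lemma cabsE (z : C) : real_complex R (cabs z) = `|z|.
Proof. by []. Qed.

Lemma convex_set_comb S (a b t : C) :
  convex_set S -> S a -> S b -> 0 <= t -> t <= 1 -> S (t * a + (1 - t) * b).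
Proof.
move=> cS Sa Sb t0 t1.
have tR : real_complex R (complex.Re t) = t by exact/RRe_real/ger0_real.
have tR' : real_complex R (1 - complex.Re t) = 1 - t.
  by rewrite -tR rmorphB rmorph1.
have := cS a b Sa Sb (complex.Re t); rewrite tR tR'; apply.
by apply/andP; split; rewrite -lecR tR ?rmorph0 ?rmorph1.
Qed.

(** Weights are complex numbers, but [0 < w.1] forces them to be real. Positivity of the total is
    proved alongside because the induction divides by it. *)
Lemma convex_set_avg S (s : seq (C * C)) :
  convex_set S -> s != [::] -> {in s, forall w, 0 < w.1 /\ S w.2} ->
  0 < \sum_(w <- s) w.1 /\
  S ((\sum_(w <- s) w.1 * w.2) / \sum_(w <- s) w.1).
Proof.
move=> cS; elim: s => // -[w x] s IH _ sP.
have [/= w0 Sx] := sP _ (mem_head _ _).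
have [->|s0] := eqVneq s [::].
  by rewrite !big_seq1 /= mulrC mulKf ?gt_eqF.
have [|W0 SW] := IH s0; first by move=> v vs; apply: sP; rewrite inE vs orbT.
rewrite !big_cons /=; set W := \sum_(v <- s) v.1 in W0 SW *.
set Y := \sum_(v <- s) _ in SW *.
have wW0 : 0 < w + W by rewrite addr_gt0.
split=> //; have -> : (w * x + Y) / (w + W) =
    w / (w + W) * x + (1 - w / (w + W)) * (Y / W).
  by field; rewrite !gt_eqF.
apply: convex_set_comb => //; first by rewrite divr_ge0 ?ltW.
by rewrite ler_pdivrMr// mul1r lerDl ltW.
Qed.

(** The inverse of [z - r] is its conjugate over its squared modulus. Conjugating the vanishing sum
    thus makes [z] the barycentre of the points [r], each weight being divided by the squared
    distance from [z] to [r]. *)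
Lemma convex_set_equilibrium S (s : seq (C * C)) (z : C) :
  convex_set S -> s != [::] ->
  {in s, forall w, [/\ 0 < w.1, S w.2 & z != w.2]} ->
  \sum_(w <- s) w.1 / (z - w.2) = 0 -> S z.
Proof.
move=> cS s0 sP sum0.
pose f (w : C * C) := (w.1 * `|z - w.2| ^- 2, w.2).
have [||W0] := convex_set_avg S [seq f w | w <- s] cS.
- by case: (s) s0.
- move=> _ /mapP[w ws ->] /=; have [w0 Sw zw] := sP w ws.
  by rewrite mulr_gt0// invr_gt0 exprn_gt0// normr_gt0 subr_eq0.
congr S; move: W0; rewrite !big_map /= => W0; apply: canLR (mulfK _) _.
  by rewrite gt_eqF.
apply/esym/eqP; rewrite -subr_eq0 mulr_sumr -sumrB.
apply/eqP/(can_inj (@conjCK C)); rewrite rmorph0 -[RHS]sum0 rmorph_sum.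
rewrite [LHS]big_seq [RHS]big_seq; apply: eq_bigr => w /sP[w0 _ zw] /=.
have nR : (`|z - w.2| ^- 2)^* = `|z - w.2| ^- 2.
  by apply/CrealP/ger0_real; rewrite invr_ge0 exprn_ge0.
rewrite mulrC -mulrBr !rmorphM /= (CrealP (ger0_real (ltW w0))) nR.
by rewrite [in RHS]invC_norm mulrA.
Qed.

Lemma convex_set_preimage S p (a b z t : C) :
  (1 < size p)%N -> convex_set S -> 0 <= t -> t <= 1 ->
  (forall x, p.[x] = a -> S x) -> (forall x, p.[x] = b -> S x) ->
  p.[z] = t * a + (1 - t) * b -> S z.
Proof.
move=> sp cS t0 t1 Sa Sb pz.
(* Once these two cases are settled, [0 < t < 1] and [a != b], so both weights are positive and
   [b - a] can be cancelled. *)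
have [/Sa//|za] := eqVneq p.[z] a; have [/Sb//|zb] := eqVneq p.[z] b.
have t'0 : 0 < 1 - t.
  rewrite subr_gt0 lt_neqAle t1 andbT; apply: contraNneq za => t1E.
  by rewrite pz t1E; apply/eqP; ring.
have {}t0 : 0 < t.
  rewrite lt_neqAle t0 andbT eq_sym; apply: contraNneq zb => t0E.
  by rewrite pz t0E; apply/eqP; ring.
have ab : b - a != 0.
  rewrite subr_eq0; apply: contraNneq za => abE.
  by rewrite pz abE; apply/eqP; ring.
have fiber c : p.[z] != c -> exists rs : seq C,
    [/\ rs != [::], {in rs, forall r, p.[r] = c}, z \notin rs &
     p^`().[z] = (p.[z] - c) * \sum_(r <- rs) (z - r)^-1].
  move=> zc; have [rs Dq] := closed_field_poly_normal (p - c%:P).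
  have sq : size (p - c%:P) = size p.
    by rewrite size_polyDl// size_polyN (leq_ltn_trans (size_polyC_leq1 c)).
  have c0 : lead_coef (p - c%:P) != 0.
    by rewrite lead_coef_eq0 -size_poly_gt0 sq (leq_trans _ sp).
  have qE x : p.[x] - c = (p - c%:P).[x] by rewrite hornerD hornerN hornerC.
  have zrs : z \notin rs.
    by rewrite -(root_scale_prod_XsubC _ _ _ _ c0) -Dq -qE subr_eq0.
  exists rs; split=> //.
  - apply: contraTneq sp => rs0; rewrite -sq Dq rs0 big_nil.
    by rewrite size_scale// size_poly1.
  - move=> r rrs; apply/eqP.
    by rewrite -subr_eq0 qE Dq root_scale_prod_XsubC.
  - have -> : p^`() = (p - c%:P)^`() by rewrite derivB derivC subr0.
    by rewrite qE Dq horner_deriv_prod_XsubC.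
have [rs [rs0 pr zr Dr]] := fiber a za; have [ss [_ ps zs Ds]] := fiber b zb.
(* The weights come from [p.[z] - a = (1 - t) * (b - a)] and [p.[z] - b = - t * (b - a)]: equating
   the two expressions for the derivative at [z] leaves [b - a] times the weighted sum equal to
   0. *)
pose s := [seq (1 - t, r) | r <- rs] ++ [seq (t, r) | r <- ss].
apply: (convex_set_equilibrium S s) => //.
- by rewrite /s; case: (rs) rs0.
- move=> w; rewrite mem_cat => /orP[] /mapP[r rrs ->] /=; split=> //.
  + exact/Sa/pr.
  + by apply: contraNneq zr => ->.
  + exact/Sb/ps.
  + by apply: contraNneq zs => ->.
- rewrite big_cat !big_map /= -!mulr_sumr.
  apply: (mulfI ab); rewrite mulr0.
  move: Dr Ds; rewrite pz; set u := \sum_(r <- rs) _; set v := \sum_(r <- ss) _.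
  move=> Du Dv; transitivity ((t * a + (1 - t) * b - a) * u -
    (t * a + (1 - t) * b - b) * v); first by ring.
  by rewrite -Du -Dv subrr.
Qed.

Lemma conv_convex X : convex_set (conv X).
Proof.
by move=> a b Xa Xb t t01 S cS XS; apply: cS (Xa S cS XS) (Xb S cS XS) t t01.
Qed.

(** Quantitative openness of [p]: [near_root] for [p - w%:P], which keeps the degree and leading
    coefficient of [p]. *)
Lemma near_preimage p (z w : C) (e : R) : (1 < size p)%N -> 0 < e ->
  cabs (w - p.[z]) < cabs (lead_coef p) * e ^+ (size p).-1 ->
  exists2 x, p.[x] = w & cabs (x - z) < e.
Proof.
move=> sp e0 wz.
have lw : (size (- w%:P)%R < size p)%N.
  by rewrite size_polyN (leq_ltn_trans (size_polyC_leq1 w)).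
have [||x] := near_root _ (p - w%:P) z (real_complex R e).
- by rewrite ltcR.
- rewrite size_polyDl// lead_coefDl// hornerD hornerN hornerC distrC.
  by rewrite -!cabsE -rmorphXn -rmorphM ltcR.
rewrite hornerD hornerN hornerC => /eqP; rewrite subr_eq0 => /eqP px.
by rewrite distrC -cabsE ltcR; exists x.
Qed.

(** Points near [p.[z]] lift to points near [z], and the [n]-th iterate at an image is the [n.+1]-st
    at its lift, so equicontinuity passes to the image. *)
Lemma fatou_horner p (z : C) : (1 < size p)%N -> fatou p z -> fatou p p.[z].
Proof.
move=> sp [r r0 Fz].
have rad (e : R) : 0 < e -> 0 < cabs (lead_coef p) * e ^+ (size p).-1.
  move=> e0; rewrite mulr_gt0 ?exprn_gt0// -ltcR cabsE normr_gt0.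
  by rewrite lead_coef_eq0 -size_poly_gt0 (leq_trans _ sp).
exists (cabs (lead_coef p) * r ^+ (size p).-1); first exact: rad.
move=> w /(near_preimage _ _ _ _ sp r0)[x <- /Fz Ex] eps /Ex[delta d0 Ed].
exists (cabs (lead_coef p) * delta ^+ (size p).-1); first exact: rad.
move=> n y /(near_preimage _ _ _ _ sp d0)[u <- /(Ed n.+1)].
by rewrite /piter !iterSr.
Qed.

End ComplexPlane.

Theorem mainTheorem1 (R : realType) (p : {poly R[i]}) (d : nat)
  (hd : (2 <= d)%N) (hsize : size p = d.+1) :
  forall z : R[i], conv (julia p) p.[z] -> conv (julia p) z.
Proof.
have sp : (1 < size p)%N by rewrite hsize ltnS (leq_trans _ hd).
move=> z /(_ (fun w => forall x, p.[x] = w -> conv (julia p) x)); apply=> //.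
- move=> a b Sa Sb t /andP[t0 t1] x px.
  apply: (convex_set_preimage _ _ p a b x (real_complex R t)) => //.
  + exact: conv_convex.
  + by rewrite -(rmorph0 (real_complex R)) lecR.
  + by rewrite -(rmorph1 (real_complex R)) lecR.
  + by rewrite px rmorphB rmorph1.
(* Here [x] itself is in the Julia set: otherwise its image [w] would be a Fatou point. *)
- move=> w Jw x px S _; apply=> Fx; apply: Jw; rewrite -px.
  exact: fatou_horner.
Qed.
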